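(* For the dueling teams problem with $n$ players, team size $k$ and deterministic feedback, there exists an algorithm that performs $\mathcal{O}(kn\log(k)+k^2\log(k)\,2^{5k})$ duels and outputs a Condorcet winning team.
   Context: Setting (deterministic dueling teams problem). $n,k$ are integers with $1\le k\le n/2$. Players are $[n]$; a team is a $k$-element subset of $[n]$. There is an unknown strict total order $\succ$ on all teams satisfying Consistency: for every two distinct players $a,b$, either $S\cup\{a\}\succ S\cup\{b\}$ for all $S\subseteq[n]\setminus\{a,b\}$ with $|S|=k-1$, or $S\cup\{b\}\succ S\cup\{a\}$ for all such $S$. In each round the learner (algorithm) adaptively selects two disjoint teams $A,B$ (a duel) and, under deterministic feedback (winning probabilities in $\{0,1\}$), learns whether $A\succ B$ or $B\succ A$. A team $A$ is a Condorcet winning team if $A\succ B$ for all teams $B$ with $A\cap B=\emptyset$.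
   Formalization: In the bound, log(k) is read as log(max(k,2)): for team size k = 1 the literal bound would be 0 duels, which is impossible already for n = 2; for every k ≥ 2 the bound is unchanged. *)

(* Defs.v *)
From mathcomp Require Import all_boot.

Set Implicit Arguments.
Unset Strict Implicit.
Unset Printing Implicit Defensive.

Definition teams (n k : nat) : {set {set 'I_n}} := [set A : {set 'I_n} | #|A| == k].

(* A relation [r] on player sets encodes the latent order on teams, [r A B]
   meaning that A is preferred to B. Its values outside [teams n k] are
   irrelevant: everything below only looks at teams. *)

Definition strict_total_order (n k : nat) (r : rel {set 'I_n}) : Prop :=
  [/\ {in teams n k, irreflexive r},
      {in teams n k & &, transitive r} &
      {in teams n k &, forall A B, A != B -> r A B || r B A}].

Definition consistent (n k : nat) (r : rel {set 'I_n}) : Prop :=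
  forall a b : 'I_n, a != b ->
    (forall S : {set 'I_n}, a \notin S -> b \notin S -> #|S| = k.-1 ->
       r (a |: S) (b |: S)) \/
    (forall S : {set 'I_n}, a \notin S -> b \notin S -> #|S| = k.-1 ->
       r (b |: S) (a |: S)).

Definition condorcet_winning (n k : nat) (r : rel {set 'I_n})
    (A : {set 'I_n}) : Prop :=
  A \in teams n k /\ forall B, B \in teams n k -> [disjoint A & B] -> r A B.

(* An adaptive deterministic learner is a binary decision tree: [Duel A B algA algB]
   lets A and B duel, then continues with [algA] if A wins and [algB] if B wins.
   The tree is fixed before the order is revealed, so the learner depends on
   the order only through the outcomes of its duels. *)
Inductive algorithm (n : nat) : Type :=
| Output of {set 'I_n}
| Duel of {set 'I_n} & {set 'I_n} & algorithm n & algorithm n.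

Fixpoint legal_duels (n k : nat) (alg : algorithm n) : bool :=
  match alg with
  | Output _ => true
  | Duel A B algA algB =>
      [&& A \in teams n k, B \in teams n k, [disjoint A & B],
          legal_duels k algA & legal_duels k algB]
  end.

Fixpoint num_duels (n : nat) (r : rel {set 'I_n}) (alg : algorithm n) : nat :=
  match alg with
  | Output _ => 0
  | Duel A B algA algB => (num_duels r (if r A B then algA else algB)).+1
  end.

Fixpoint output (n : nat) (r : rel {set 'I_n}) (alg : algorithm n) :
    {set 'I_n} :=
  match alg with
  | Output A => A
  | Duel A B algA algB => output r (if r A B then algA else algB)
  end.

(* Main.v *)
Require Import Defs.
From mathcomp Require Import all_boot all_order all_algebra.
From mathcomp Require Import reals exp.
From mathcomp Require Import zify lra.

Set Implicit Arguments.
Unset Strict Implicit.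
Unset Printing Implicit Defensive.

Import Order.TTheory GRing.Theory Num.Theory.

(* If A beats a disjoint team B, trade the members of A one by one against
   partners in B.  The winner flips somewhere along the way, and a binary search
   locates a flip with log k duels; consistency then shows that the member of A
   traded there beats its partner.  The matching between A and B is free.

   The learner collects a set K of such relations between players.  Contenders
   are players with fewer than 2k dominators in K.  As long as there are more
   than 6k contenders, counting in-degrees gives k disjoint pairs of contenders
   not yet compared, and duelling along them yields a new relation below a
   contender; this happens at most 2kn times.  With at most 6k contenders, only
   12k^2 further relations below contenders are possible.  Take a K-closed team A
   (a strongest team is one) and test it against all teams of contenders disjoint
   from A, at most 2^(5k) of them.  If A always wins, it is Condorcet winning;
   if it loses, then since A is closed the search reveals a relation not in K.  *)

(** * Learners that start from partial knowledge of the order *)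

Definition player_beats (n k : nat) (r : rel {set 'I_n}) (a b : 'I_n) : Prop :=
  forall S : {set 'I_n}, a \notin S -> b \notin S -> #|S| = k.-1 ->
    r (a |: S) (b |: S).

(** [P] is what has been learnt so far. Decision trees are built from their leaves upwards: each
    branch of a duel only has to cope with the orders that agree with its outcome. *)
Definition solvable (n k : nat) (P : rel {set 'I_n} -> Prop) (c : nat) : Prop :=
  exists alg : algorithm n, legal_duels k alg /\
    forall r, strict_total_order k r -> consistent k r -> P r ->
      num_duels r alg <= c /\ condorcet_winning k r (output r alg).

Section Solvable.
Variables n k : nat.
Hypothesis k_gt0 : 0 < k.
Implicit Types (P Q : rel {set 'I_n} -> Prop) (A B : {set 'I_n}) (c : nat).
Implicit Types (s : seq ('I_n * 'I_n)).

Lemma solvable_weaken P Q c d :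
  (forall r, strict_total_order k r -> consistent k r -> Q r -> P r) ->
  c <= d -> solvable k P c -> solvable k Q d.
Proof.
move=> QP le_cd [alg [legal correct]]; exists alg; split=> // r ord cons Qr.
have [le_c win] := correct r ord cons (QP r ord cons Qr).
by split=> //; apply: leq_trans le_cd.
Qed.

Lemma solvable_output P A c :
  (forall r, strict_total_order k r -> consistent k r -> P r ->
     condorcet_winning k r A) -> solvable k P c.
Proof. by move=> win; exists (Output A); split=> // r ord cons /(win r ord cons). Qed.

Lemma teams_disjoint_neq A B :
  A \in teams n k -> [disjoint A & B] -> A != B.
Proof.
rewrite inE => /eqP cardA disAB; apply/eqP=> eqAB.
by move: disAB; rewrite -eqAB -setI_eq0 setIid -cards_eq0 cardA; case: k k_gt0.
Qed.

Lemma solvable_duel P c A B :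
  A \in teams n k -> B \in teams n k -> [disjoint A & B] ->
  solvable k (fun r => P r /\ r A B) c ->
  solvable k (fun r => P r /\ r B A) c ->
  solvable k P c.+1.
Proof.
move=> tA tB disAB [algA [legA corA]] [algB [legB corB]].
exists (Duel A B algA algB); split=> [|r ord cons Pr] /=; first by rewrite tA tB disAB legA.
have [_ _ total] := ord.
case: ifPn => [rAB | /negPf rAB]; first exact: corA.
have rBA : r B A by have := total A B tA tB (teams_disjoint_neq tA disAB); rewrite rAB.
exact: corB.
Qed.

(** The tests stop at the first loss, so the continuation cost [c] is paid only once. *)
Lemma solvable_test P c A (Bs : seq {set 'I_n}) :
  A \in teams n k ->
  (forall B, B \in Bs -> B \in teams n k /\ [disjoint A & B]) ->
  (forall B, B \in Bs -> solvable k (fun r => P r /\ r B A) c) ->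
  solvable k (fun r => P r /\ forall B, B \in Bs -> r A B) c ->
  solvable k P (c + size Bs).
Proof.
move=> tA; elim: Bs P => [|B Bs IH] P legal lose win.
  by rewrite addn0; apply: solvable_weaken win => // r _ _ Pr; split.
have [tB disAB] := legal B (mem_head _ _).
rewrite addnS; apply: (solvable_duel tA tB disAB); last first.
  by apply: solvable_weaken (lose B (mem_head _ _)) => //; apply: leq_addr.
apply: IH => [B' B'Bs | B' B'Bs |].
- by apply: legal; rewrite inE B'Bs orbT.
- have B'in : B' \in B :: Bs by rewrite inE B'Bs orbT.
  by apply: solvable_weaken (lose B' B'in) => // r _ _ [[]].
- apply: solvable_weaken win => // r _ _ [[Pr rAB] rABs]; split=> // B'.
  by rewrite inE => /predU1P[->|/rABs].
Qed.

(** * Trading members between two teams and searching for a flip *)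

Lemma exchange_beats (r : rel {set 'I_n}) (a b : 'I_n) (S T : {set 'I_n}) :
  strict_total_order k r -> consistent k r -> a != b ->
  a \notin S -> b \notin S -> #|S| = k.-1 ->
  a \notin T -> b \notin T -> #|T| = k.-1 ->
  r (a |: S) (b |: T) -> r (a |: T) (b |: S) -> player_beats k r a b.
Proof.
move=> [irr tr _] cons neq_ab aS bS cardS aT bT cardT rST rTS.
have team (x : 'I_n) (U : {set 'I_n}) : x \notin U -> #|U| = k.-1 -> x |: U \in teams n k.
  by move=> xU cardU; rewrite inE cardsU1 xU cardU add1n prednK.
(* If [b] beat [a], the order would contain the cycle [b |: S], [a |: S], [b |: T], [a |: T],
   [b |: S]. *)
case: (cons a b neq_ab) => // ba; exfalso.
have r1 := ba S aS bS cardS; have r2 := ba T aT bT cardT.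
have r3 : r (b |: S) (b |: T).
  by apply: (tr (a |: S)) => //; apply: team.
have r4 : r (b |: S) (a |: T).
  by apply: (tr (b |: T)) => //; apply: team.
have r5 : r (a |: T) (a |: T).
  by apply: (tr (b |: S)) => //; apply: team.
by rewrite irr ?team in r5.
Qed.

(* Side [true] starts as the team of first components; its first [i] members
   have been traded against their partners. *)
Definition traded s (i : nat) (side : bool) : seq 'I_n :=
  if side then unzip2 (take i s) ++ unzip1 (drop i s)
  else unzip1 (take i s) ++ unzip2 (drop i s).

Definition traded_team s i side : {set 'I_n} := [set x in traded s i side].

Lemma traded_perm s i :
  perm_eq (traded s i true ++ traded s i false) (unzip1 s ++ unzip2 s).
Proof.
rewrite -{3 4}(cat_take_drop i s) /unzip1 /unzip2 !map_cat /traded.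
by apply/permP=> p; rewrite !count_cat /unzip1 /unzip2; lia.
Qed.

Lemma traded_uniq s i :
  uniq (unzip1 s ++ unzip2 s) -> uniq (traded s i true ++ traded s i false).
Proof. by rewrite (perm_uniq (traded_perm s i)). Qed.

Lemma traded_size s i side : size (traded s i side) = size s.
Proof.
by case: side; rewrite size_cat !size_map -size_cat cat_take_drop.
Qed.

Lemma traded_teamP s i side : uniq (unzip1 s ++ unzip2 s) -> size s = k ->
  traded_team s i side \in teams n k.
Proof.
move=> /(traded_uniq i); rewrite cat_uniq => /and3P[u1 _ u2] sz.
rewrite inE cardsE -sz -(traded_size s i side); apply/eqP/card_uniqP.
by case: side.
Qed.

Lemma traded_team_disjoint s i : uniq (unzip1 s ++ unzip2 s) ->
  [disjoint traded_team s i true & traded_team s i false].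
Proof.
move=> /(traded_uniq i); rewrite cat_uniq => /and3P[_ /hasPn dis _].
rewrite disjoint_sym; apply/pred0Pn=> -[x /=]; rewrite !inE.
by case/andP=> /dis /negPf /= ->.
Qed.

(** One trade turns the sides [a |: S], [b |: T] into [b |: S], [a |: T], where [S] and [T] collect
    the members that do not move; a flip is then the situation of [exchange_beats]. *)
Lemma trade_beats s i p (r : rel {set 'I_n}) :
  strict_total_order k r -> consistent k r ->
  uniq (unzip1 s ++ unzip2 s) -> size s = k -> i < k ->
  r (traded_team s i true) (traded_team s i false) ->
  r (traded_team s i.+1 false) (traded_team s i.+1 true) ->
  let q := nth p s i in player_beats k r q.1 q.2.
Proof.
move=> ord cons us sz lt_ik; rewrite -sz in lt_ik.
have := traded_uniq i us; rewrite /traded_team /traded (drop_nth p) //.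
rewrite (take_nth p) // /unzip1 /unzip2 !map_rcons !map_cons.
case: (nth p s i) => a b /=.
set t2 := map snd (take i s); set t1 := map fst (take i s).
set d2 := map snd (drop i.+1 s); set d1 := map fst (drop i.+1 s) => u.
have perm1 : perm_eq ((t2 ++ a :: d1) ++ (t1 ++ b :: d2))
                     (a :: b :: (t2 ++ d1) ++ (t1 ++ d2)).
  by apply/permP=> x; rewrite /= !count_cat /=; lia.
rewrite (perm_uniq perm1) /= inE negb_or in u.
case/and3P: u => /andP[neq_ab]; rewrite mem_cat negb_or => /andP[aS aT].
rewrite mem_cat negb_or cat_uniq => /andP[bS bT] /and3P[uS _ uT].
have szS : size t2 + size d1 = k.-1.
  by rewrite !size_map -sz size_drop size_takel ?(ltnW lt_ik) //; clear -lt_ik; lia.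
have szT : size t1 + size d2 = k.-1.
  by rewrite !size_map -sz size_drop size_takel ?(ltnW lt_ik) //; clear -lt_ik; lia.
have setE x (u1 u2 : seq 'I_n) : [set y in u1 ++ x :: u2] = x |: [set y in u1 ++ u2].
  by apply/setP=> y; rewrite !inE !mem_cat inE orbCA.
rewrite !cat_rcons !setE => r1 r2.
apply: exchange_beats r1 r2 => //; rewrite ?inE //.
- by rewrite cardsE; move/card_uniqP: uS => ->; rewrite size_cat.
- by rewrite cardsE; move/card_uniqP: uT => ->; rewrite size_cat.
Qed.

(** Invariant: side [true] wins at stage [lo] and loses at stage [hi]. A duel at an intermediate
    stage keeps it on one of the two halves. *)
Lemma solvable_binary_search P s t c lo hi :
  uniq (unzip1 s ++ unzip2 s) -> size s = k ->
  lo < hi -> hi <= k -> hi - lo <= 2 ^ t ->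
  (forall r, strict_total_order k r -> consistent k r -> P r ->
    r (traded_team s lo true) (traded_team s lo false) /\
    r (traded_team s hi false) (traded_team s hi true)) ->
  (forall p, p \in s -> solvable k (fun r => P r /\ player_beats k r p.1 p.2) c) ->
  solvable k P (c + t).
Proof.
move=> us sz; elim: t P lo hi => [|t IH] P lo hi lt_lh le_hk le_2t Pr sol.
  have hiE : hi = lo.+1 by rewrite expn0 in le_2t; lia.
  have lt_lok : lo < k by rewrite -hiE.
  have [p ps] : exists p, p \in s.
    by case: (s) sz k_gt0 => [<- //|p ? _ _]; exists p; apply: mem_head.
  have qs : nth p s lo \in s by apply: mem_nth; rewrite sz.
  rewrite addn0; apply: solvable_weaken (sol _ qs) => // r ord cons Pr0; split=> //.
  have [r1 r2] := Pr r ord cons Pr0; rewrite hiE in r2.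
  exact: trade_beats r1 r2.
(* A short interval needs no duel at this level; otherwise [lo + 2 ^ t] lies strictly inside. *)
have [le1|gt1] := leqP (hi - lo) (2 ^ t).
  by apply: solvable_weaken (IH P lo hi lt_lh le_hk le1 Pr sol) => //; lia.
have t_gt0 : 0 < 2 ^ t by rewrite expn_gt0.
rewrite expnS in le_2t.
set mid := lo + 2 ^ t.
have dis := traded_team_disjoint mid us.
rewrite addnS; apply: (solvable_duel _ _ dis); rewrite ?traded_teamP //.
- apply: (IH _ mid hi); rewrite ?/mid; try lia.
    by move=> r ord cons [Pr0 ?]; have [] := Pr r ord cons Pr0.
  by move=> p ps; apply: solvable_weaken (sol p ps) => // r _ _ [[]].
- apply: (IH _ lo mid); rewrite ?/mid; try lia.
    by move=> r ord cons [Pr0 ?]; have [] := Pr r ord cons Pr0.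
  by move=> p ps; apply: solvable_weaken (sol p ps) => // r _ _ [[]].
Qed.

(** After all [k] trades the two teams have changed sides, so a single known outcome supplies both
    ends of the search. *)
Lemma solvable_find P s c :
  uniq (unzip1 s ++ unzip2 s) -> size s = k ->
  (forall r, P r -> r [set x in unzip1 s] [set x in unzip2 s]) ->
  (forall p, p \in s -> solvable k (fun r => P r /\ player_beats k r p.1 p.2) c) ->
  solvable k P (c + up_log 2 k).
Proof.
move=> us sz Pr sol.
apply: (solvable_binary_search (s := s) (lo := 0) (hi := k)) => //.
  by rewrite subn0; apply: up_logP.
move=> r _ _ /Pr r12; rewrite /traded_team /traded take0 drop0 -sz.
by rewrite take_size drop_size !cats0.
Qed.

Lemma solvable_match P s c :
  uniq (unzip1 s ++ unzip2 s) -> size s = k ->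
  (forall p, p \in s -> solvable k (fun r => P r /\ player_beats k r p.1 p.2) c) ->
  (forall p, p \in s -> solvable k (fun r => P r /\ player_beats k r p.2 p.1) c) ->
  solvable k P (c + (up_log 2 k).+1).
Proof.
move=> us sz sol1 sol2.
have t1 := traded_teamP 0 true us sz; have t2 := traded_teamP 0 false us sz.
have dis := traded_team_disjoint 0 us.
rewrite /traded_team /traded take0 drop0 /= in t1 t2 dis.
rewrite addnS; apply: (solvable_duel t1 t2 dis).
  apply: (solvable_find us sz) => [r []// | p ps].
  by apply: solvable_weaken (sol1 p ps) => // r _ _ [[]].
pose s' := [seq (p.2, p.1) | p <- s].
have s1 : unzip1 s' = unzip2 s by rewrite /unzip1 /unzip2 -map_comp; apply: eq_map.
have s2 : unzip2 s' = unzip1 s by rewrite /unzip1 /unzip2 -map_comp; apply: eq_map.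
apply: (@solvable_find _ s'); rewrite ?s1 ?s2 ?size_map //.
- by rewrite uniq_catC.
- by move=> r [].
- move=> _ /mapP[p ps ->] /=.
  by apply: solvable_weaken (sol2 p ps) => // r _ _ [[]].
Qed.

End Solvable.

(** * Known relations between players, contenders and unknown matchings *)

Section Knowledge.
Variables n k : nat.
Hypothesis k_gt0 : 0 < k.
Implicit Types (K : {set 'I_n * 'I_n}) (A B : {set 'I_n}) (a b x y : 'I_n).

Definition knows K (r : rel {set 'I_n}) : Prop :=
  forall a b, (a, b) \in K -> player_beats k r a b.

Definition dominators K x : {set 'I_n} := [set y | (y, x) \in K].

(* Players not yet known to be outside the best [2 * k]. *)
Definition contenders K : {set 'I_n} := [set x | #|dominators K x| < 2 * k].

(** Potential that bounds the number of searches. By truncated subtraction only contenders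
    contribute. *)
Definition deficit K : nat := \sum_x (2 * k - #|dominators K x|).

Definition closed_under K A : bool :=
  [forall a in A, dominators K a \subset A].

Lemma knows_setU1 K a b (r : rel {set 'I_n}) :
  knows K r -> player_beats k r a b -> knows ((a, b) |: K) r.
Proof. by move=> known beats x y /setU1P[[-> ->]|/known]. Qed.

Lemma dominatorsU1 K a b x :
  dominators ((a, b) |: K) x = if x == b then a |: dominators K x else dominators K x.
Proof.
apply/setP=> y; rewrite !inE xpair_eqE.
by case: (x =P b) => [->|_]; rewrite ?andbF ?andbT ?inE.
Qed.

Lemma deficit_setU1 K a b : (a, b) \notin K -> b \in contenders K ->
  deficit ((a, b) |: K) < deficit K.
Proof.
rewrite inE => abK b_cont; rewrite /deficit (bigD1 b) //= [ltnRHS](bigD1 b) //=.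
have -> : \sum_(x | x != b) (2 * k - #|dominators ((a, b) |: K) x|) =
          \sum_(x | x != b) (2 * k - #|dominators K x|).
  by apply: eq_bigr => x /negPf xb; rewrite dominatorsU1 xb.
have a_new : a \notin dominators K b by rewrite inE.
rewrite ltn_add2r dominatorsU1 eqxx cardsU1 a_new add1n; move: b_cont; set d := #|_|; lia.
Qed.

Lemma contenders_setU1 K p : contenders (p |: K) \subset contenders K.
Proof.
apply/subsetP=> x; rewrite !inE; apply: leq_ltn_trans.
by apply/subset_leq_card/subsetP=> y; rewrite !inE => ->; rewrite orbT.
Qed.

Lemma deficit_le K : deficit K <= #|contenders K| * (2 * k).
Proof.
rewrite /deficit (bigID (mem (contenders K))) /= [X in _ + X]big1 ?addn0 => [|x].
  by rewrite -sum_nat_const; apply: leq_sum => x _; apply: leq_subr.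
by rewrite inE -leqNgt -subn_eq0 => /eqP.
Qed.

(** Double counting of ordered pairs: if all of [R] were compared, then with [m = #|R|] the diagonal
    and the in-degrees would give [m * m <= m + 2 * m * (2 * k - 1)], hence [m < 4 * k]. *)
Lemma unknown_pair K (R : {set 'I_n}) :
  R \subset contenders K -> 4 * k <= #|R| ->
  exists a b, [/\ a \in R, b \in R, a != b & ((a, b) \notin K) && ((b, a) \notin K)].
Proof.
move=> sub_R large.
case: (boolP [exists a in R, exists b in R,
  [&& a != b, (a, b) \notin K & (b, a) \notin K]]) => [|/exists_inPn known].
  case/exists_inP=> a aR /exists_inP[b bR /and3P[ab k1 k2]].
  by exists a, b; split=> //; rewrite k1.
exfalso.
have in_deg x : x \in R -> \sum_(y in R) ((y, x) \in K) <= 2 * k - 1.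
  move=> /(subsetP sub_R); rewrite inE => lt_2k.
  suff : \sum_(y in R) ((y, x) \in K) <= #|dominators K x|.
  move=> /leq_ltn_trans/(_ lt_2k); lia.
  rewrite -sum1_card big_mkcond [leqRHS]big_mkcond /=; apply: leq_sum => y _.
  by rewrite inE; case: (y \in R); case: ((y, x) \in K).
have upper : \sum_(x in R) \sum_(y in R) ((y, x) \in K) <= #|R| * (2 * k - 1).
  by rewrite -sum_nat_const; apply: leq_sum.
have lower : \sum_(x in R) \sum_(y in R) 1 <=
    \sum_(x in R) \sum_(y in R) ((x == y) + ((y, x) \in K) + ((x, y) \in K)).
  apply: leq_sum => x xR; apply: leq_sum => y yR.
  have /exists_inPn/(_ y yR) := known x xR.
  by case: (x == y); case: ((y, x) \in K); case: ((x, y) \in K).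
have diag : \sum_(x in R) \sum_(y in R) (x == y) = #|R|.
  rewrite -sum1_card; apply: eq_bigr => x xR.
  rewrite (bigD1 x) //= eqxx big1 // => y /andP[_ ne].
  by rewrite eq_sym (negPf ne).
move: lower; under eq_bigr => x _ do rewrite sum1_card.
rewrite sum_nat_const.
under [leqRHS]eq_bigr => x _ do rewrite !big_split.
rewrite !big_split /= diag [X in _ + X]exchange_big /=.
move: upper large; set s := \sum_(x in R) _; move: s #|R| => s m le_s le_m le_mm.
have : m * (4 * k) <= m * m by rewrite leq_mul2l le_m orbT.
by nia.
Qed.

(** Greedy choice: fewer than [k] pairs occupy fewer than [2 * k] players, so at least [4 * k] of
    the [6 * k] contenders remain for [unknown_pair]. *)
Lemma unknown_matching K j : 6 * k <= #|contenders K| -> j <= k ->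
  exists s : seq ('I_n * 'I_n),
    [/\ size s = j, uniq (unzip1 s ++ unzip2 s) &
      forall p, p \in s -> [/\ p.1 \in contenders K, p.2 \in contenders K,
        (p.1, p.2) \notin K & (p.2, p.1) \notin K]].
Proof.
move=> large; elim: j => [|j IH] lt_jk; first by exists [::].
have [s [sz us unk]] := IH (ltnW lt_jk).
pose R := contenders K :\: [set x in unzip1 s ++ unzip2 s].
have [||a [b [aR bR ab /andP[k1 k2]]]] := @unknown_pair K R.
- exact: subsetDl.
- have : #|[set x in unzip1 s ++ unzip2 s]| <= 2 * j.
    rewrite cardsE; apply: leq_trans (card_size _) _.
    by rewrite size_cat !size_map sz mul2n addnn.
  move=> le_card; rewrite cardsD.
  have := leq_trans (subset_leq_card (subsetIr (contenders K) _)) le_card.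
  move: large; move: #|contenders K| #|_ :&: _| => m1 m2; lia.
move: aR bR; rewrite !in_setD !inE => /andP[aN aC] /andP[bN bC].
exists ((a, b) :: s); split=> [|| p]; first by rewrite /= sz.
  rewrite /= uniq_catC /= uniq_catC us andbT.
  rewrite !mem_cat !inE !negb_or in aN bN *.
  by case/andP: aN => -> ->; case/andP: bN => -> ->; rewrite ab.
by rewrite inE => /predU1P[-> /=|/unk //]; split=> //; rewrite inE.
Qed.

(** * Strongest teams and replacement of members *)

Lemma exchange_winner (r : rel {set 'I_n}) A a b :
  A \in teams n k -> a \in A -> b \notin A -> player_beats k r b a ->
  r (b |: A :\ a) A.
Proof.
rewrite inE => /eqP cardA aA bA beats.
rewrite -{2}(setD1K aA); apply: beats; first by rewrite !inE (negPf bA) andbF.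
  by rewrite !inE eqxx.
by have := cardsD1 a A; rewrite aA cardA add1n => ->.
Qed.

Lemma exchange_team A a b :
  A \in teams n k -> a \in A -> b \notin A -> b |: A :\ a \in teams n k.
Proof.
rewrite !inE => /eqP cardA aA bA.
rewrite cardsU1 !inE (negPf bA) andbF /=.
by have := cardsD1 a A; rewrite aA cardA => ->.
Qed.

(** Take a team with the fewest better teams in the family. Any better team would have strictly
    fewer, by transitivity and irreflexivity. *)
Lemma undominated_team (r : rel {set 'I_n}) (P : pred {set 'I_n}) A0 :
  strict_total_order k r -> A0 \in teams n k -> P A0 ->
  exists2 A, (A \in teams n k) && P A & forall B, B \in teams n k -> P B -> ~~ r B A.
Proof.
move=> [irr tr _] t0 P0.
pose better A := [set B | [&& B \in teams n k, P B & r B A]].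
case: (@arg_minnP _ A0 [pred A | (A \in teams n k) && P A] (fun A => #|better A|)).
  by rewrite /= t0 P0.
move=> A /andP[tA PA] min; exists A; rewrite ?tA // => B tB PB; apply/negP=> rBA.
have /min : (B \in teams n k) && P B by rewrite tB.
rewrite leqNgt => /negP[]; apply/proper_card/properP; split.
  apply/subsetP=> C; rewrite inE => /and3P[tC PC rCB].
  by rewrite inE tC PC; apply: (tr B).
by exists B; rewrite inE ?tB ?PB ?irr.
Qed.

(** In a strongest team, a dominator from outside could replace the member it beats and improve the
    team. *)
Lemma closed_team_exists K (r : rel {set 'I_n}) :
  k <= n -> strict_total_order k r -> knows K r ->
  exists2 A, A \in teams n k & closed_under K A.
Proof.
move=> le_kn ord known.
have [A0 tA0] : exists A0, A0 \in teams n k.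
  have : 0 < #|teams n k| by rewrite card_draws card_ord bin_gt0.
  by case/card_gt0P=> A0; exists A0.
have [A /andP[tA _] max] := undominated_team (P := predT) ord tA0 isT.
exists A => //; apply/forall_inP=> a aA; apply/subsetP=> b; rewrite inE => ba.
apply/negPn/negP=> bA.
have := max _ (exchange_team tA aA bA) isT.
by rewrite (exchange_winner tA aA bA (known _ _ ba)).
Qed.

Lemma closed_sub_contenders K A :
  A \in teams n k -> closed_under K A -> A \subset contenders K.
Proof.
rewrite inE => /eqP cardA /forall_inP cl; apply/subsetP=> a /cl/subset_leq_card.
by rewrite inE cardA => /leq_ltn_trans; apply; lia.
Qed.

(* A strongest team disjoint from [A] consists of contenders: otherwise one of
   the [2 * k] dominators of an eliminated member could replace that member. *)
Lemma condorcet_among_contenders K (r : rel {set 'I_n}) A :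
  strict_total_order k r -> knows K r -> A \in teams n k ->
  (forall B, B \in teams n k -> [disjoint A & B] -> B \subset contenders K -> r A B) ->
  condorcet_winning k r A.
Proof.
move=> ord known tA wins; split=> // B0 tB0 dis0.
have [B /andP[tB /= disB] max] :=
  undominated_team (P := fun B => [disjoint A & B]) ord tB0 dis0.
have rAB : r A B.
  apply: wins => //; apply/subsetP=> x xB; apply/negPn/negP=> x_out.
  (* [A :|: B :\ x] has at most [2 * k - 1] players, fewer than the dominators of [x]. *)
  have [y ydom yAB] : exists2 y, y \in dominators K x & y \notin A :|: B :\ x.
    apply/subsetPn/negP=> /subset_leq_card/leq_trans/(_ (leq_card_setU _ _)).
    move: x_out tA tB; rewrite !inE -leqNgt => ge_2k /eqP-> /eqP cardB.
    move=> /(leq_trans ge_2k); have := cardsD1 x B; rewrite xB cardB.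
    by move: #|_ :\ _| => m; lia.
  have yA : y \notin A by apply: contra yAB; rewrite !inE => ->.
  have beats : player_beats k r y x by apply: known; rewrite inE in ydom.
  have xA : x \notin A by rewrite (disjointFl disB xB).
  (* A loop [(x, x)] in [K] would make a team beat itself. *)
  have [eq_yx|neq_yx] := eqVneq y x.
    have [irr _ _] := ord.
    have xS : x \notin B :\ x by rewrite !inE eqxx.
    have := beats (B :\ x); rewrite eq_yx setD1K // => /(_ xS xS).
    rewrite irr // => ne; suff : false by []; apply: ne.
    by move: tB (cardsD1 x B); rewrite xB inE add1n => /eqP-> ->.
  have yB : y \notin B by apply: contra yAB; rewrite !inE neq_yx => ->; rewrite orbT.
  have disB' : [disjoint A & y |: B :\ x].
    rewrite disjoint_sym disjoints_subset subUset sub1set in_setC yA /=.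
    by rewrite -disjoints_subset disjoint_sym; apply: disjointWr disB; apply: subD1set.
  have := max _ (exchange_team tB xB yB) disB'.
  by rewrite (exchange_winner tB xB yB beats).
have [_ tr total] := ord.
have [<- // | neq] := eqVneq B B0.
have := total B B0 tB tB0 neq; rewrite (negPf (max B0 tB0 dis0)) orbF => rBB0.
exact: (tr B).
Qed.

(** * The two phases of the learner and their duel counts *)

Lemma solvable_reduce c K :
  (forall K', #|contenders K'| <= 6 * k -> solvable k (knows K') c) ->
  solvable k (knows K) (c + deficit K * (up_log 2 k).+1).
Proof.
move=> base; have [m] := ubnP (deficit K).
elim: m K => // m IH K /ltnSE def_le.
have [small|/ltnW large] := leqP #|contenders K| (6 * k).
  by apply: solvable_weaken (base K small) => //; apply: leq_addr.
have [s [sz us unk]] := unknown_matching large (leqnn k).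
have step a b : (a, b) \notin K -> b \in contenders K ->
    solvable k (fun r => knows K r /\ player_beats k r a b)
      (c + (deficit K).-1 * (up_log 2 k).+1).
  move=> abK bC; have lt := deficit_setU1 abK bC.
  apply: solvable_weaken (IH ((a, b) |: K) (leq_trans lt def_le)) => [r _ _ []|].
    exact: knows_setU1.
  by rewrite leq_add2l leq_mul2r; lia.
(* Any matched pair is a missing relation below a contender, so the deficit cannot be zero. *)
have def_gt0 : 0 < deficit K.
  case: (s) sz k_gt0 unk => [<- //|[a b] ? _ _ /(_ _ (mem_head _ _))].
  by case=> _ bC abK _; have := deficit_setU1 abK bC; lia.
rewrite -(prednK def_gt0) mulSn addnCA addnC.
apply: (solvable_match k_gt0 us sz) => -[a b] /unk[aC bC abK baK]; exact: step.
Qed.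

(** A round costs at most [2 ^ (5 * k)] tests and one search. The lost test itself starts the
    search, and the relation found lowers the deficit, so there are at most [(deficit K).+1]
    rounds. *)
Lemma solvable_few_contenders K :
  k <= n -> #|contenders K| <= 6 * k ->
  solvable k (knows K) ((deficit K).+1 * (2 ^ (5 * k) + up_log 2 k)).
Proof.
move=> le_kn; have [m] := ubnP (deficit K).
elim: m K => // m IH K /ltnSE def_le few.
case: (pickP [pred A | (A \in teams n k) && closed_under K A]) => [A|none]; last first.
  (* Without a closed team no order agrees with [K], so the output is arbitrary. *)
  apply: (@solvable_output _ _ _ set0) => r ord _ kn.
  have [A tA clA] := closed_team_exists le_kn ord kn.
  by have := none A; rewrite /= tA clA.
case/andP=> tA clA; have subA := closed_sub_contenders tA clA.
have cardA : #|A| = k by move: tA; rewrite inE => /eqP.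
pose Bs := enum [set B in powerset (contenders K :\: A) | B \in teams n k].
have BsP B : (B \in Bs) =
    [&& B \in teams n k, [disjoint A & B] & B \subset contenders K].
  rewrite mem_enum inE powersetE subsetD disjoint_sym andbC.
  by rewrite [X in _ && X]andbC.
have size_Bs : size Bs <= 2 ^ (5 * k).
  rewrite -cardE; apply: (@leq_trans #|powerset (contenders K :\: A)|).
    by apply/subset_leq_card/subsetP=> B; rewrite inE => /andP[].
  (* [A] takes [k] of the at most [6 * k] contenders and leaves at most [5 * k]. *)
  rewrite card_powerset leq_pexp2l // cardsD (setIidPr subA) cardA; lia.
apply: (@solvable_weaken _ _ (knows K) _
  (deficit K * (2 ^ (5 * k) + up_log 2 k) + up_log 2 k + size Bs)) => //.
  by rewrite mulSn -addnA [leqLHS]addnC leq_add2r [leqLHS]addnC leq_add2r.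
apply: (solvable_test k_gt0 tA) => [B | B |].
- by rewrite BsP => /and3P[].
- rewrite BsP => /and3P[tB disAB subB].
  have cardB : #|B| = k by move: tB; rewrite inE => /eqP.
  have szAB : size (enum B) = size (enum A) by rewrite -!cardE cardA.
  apply: (@solvable_find _ _ k_gt0 _ (zip (enum B) (enum A))).
  + rewrite unzip1_zip ?unzip2_zip ?szAB // cat_uniq !enum_uniq andbT /=.
    apply/hasPn=> x; rewrite /= !mem_enum => xA.
    by rewrite (disjointFr disAB xA).
  + by rewrite size1_zip ?szAB // -cardE.
  + by move=> r [_]; rewrite unzip1_zip ?unzip2_zip ?szAB // !set_enum.
  + move=> -[b a] ba.
    have : b \in unzip1 (zip (enum B) (enum A)) by apply: (map_f fst ba).
    rewrite unzip1_zip ?szAB // mem_enum => bB.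
    have : a \in unzip2 (zip (enum B) (enum A)) by apply: (map_f snd ba).
    rewrite unzip2_zip ?szAB // mem_enum => aA.
    (* Closedness would put [b] into [A], which is disjoint from [B]. *)
    have baK : (b, a) \notin K.
      apply: contraFN (disjointFl disAB bB) => baK.
      by apply: (subsetP (forall_inP clA a aA)); rewrite inE.
    have lt := deficit_setU1 baK (subsetP subA a aA).
    have few' := leq_trans (subset_leq_card (contenders_setU1 K (b, a))) few.
    apply: solvable_weaken (IH _ (leq_trans lt def_le) few') => [r _ _ [[kn _] be]|].
      exact: knows_setU1.
    by rewrite leq_mul2r lt orbT.
- apply: (@solvable_output _ _ _ A) => r ord _ [kn wins].
  apply: condorcet_among_contenders ord kn tA _ => B tB disAB subB.
  by apply: wins; rewrite BsP tB disAB.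
Qed.

(** The deficit is at most [2 * k * n] initially, and at most [6 * k * (2 * k)] once few contenders
    are left. *)
Lemma solvable_all : k <= n ->
  solvable k (fun _ : rel {set 'I_n} => True)
    ((12 * k ^ 2).+1 * (2 ^ (5 * k) + up_log 2 k) + 2 * k * n * (up_log 2 k).+1).
Proof.
move=> le_kn; apply: solvable_weaken (@solvable_reduce
  ((12 * k ^ 2).+1 * (2 ^ (5 * k) + up_log 2 k)) set0 _).
- by move=> r _ _ _ a b; rewrite inE.
- rewrite leq_add2l leq_mul2r; apply/orP; right.
  apply: leq_trans (deficit_le _) _; rewrite mulnC leq_mul2l.
  by rewrite -[X in _ <= X]card_ord max_card orbT.
- move=> K few; apply: solvable_weaken (solvable_few_contenders le_kn few) => //.
  rewrite leq_mul2r ltnS; apply/orP; right; apply: leq_trans (deficit_le K) _.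
  by rewrite expnS expn1; nia.
Qed.

End Knowledge.

(** * Passage to natural logarithms *)

Local Open Scope ring_scope.

(** Rounding up less than doubles [k], so [2 ^ up_log 2 k] is at most [maxn k 2 ^ 2]. The maximum
    with 2 keeps the logarithm positive at [k = 1]. *)
Lemma up_log2_le_ln (R : realType) (k : nat) :
  (1 <= k)%N -> (up_log 2 k)%:R * ln 2 <= 2 * ln (maxn k 2)%:R :> R.
Proof.
move=> k_gt0; have ln2_gt0 : 0 < ln 2 :> R by rewrite ln_gt0 // ltr1n.
have max_gt0 : 0 < (maxn k 2)%:R :> R by rewrite ltr0n; lia.
have : (2 ^ up_log 2 k <= maxn k 2 ^ 2)%N.
  have [le1|gt1] := leqP k 1.
    by have -> : k = 1%N by lia.
  have [lo hi] := andP (up_log_bounds (isT : 1 < 2)%N gt1).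
  have up_gt0 : (0 < up_log 2 k)%N by rewrite up_log_gt0.
  by rewrite -(prednK up_gt0) !expnS; nia.
rewrite -(ler_nat R) !natrX => le_pow.
rewrite [leLHS]mulr_natl [leRHS]mulr_natl -!lnXn //.
by rewrite ler_ln // posrE exprn_gt0.
Qed.

Theorem theorem6 (R : realType) :
  exists C : R, 0 < C /\
    forall n k : nat, (1 <= k)%N -> (2 * k <= n)%N ->
      exists alg : algorithm n,
        legal_duels k alg /\
        forall r : rel {set 'I_n},
          strict_total_order k r -> consistent k r ->
          (num_duels r alg)%:R <=
            C * (k%:R * n%:R * ln (maxn k 2)%:R +
                 k%:R ^+ 2 * ln (maxn k 2)%:R * 2 ^+ (5 * k)) /\
          condorcet_winning k r (output r alg).
Proof.
have ln2_gt0 : 0 < ln 2 :> R by rewrite ln_gt0 // ltr1n.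
(* [12 * k ^ 2 + 1 <= 13 * k ^ 2], and absorbing [up_log 2 k] into [2 ^ (5 * k)] doubles 13 to 26.
   Dividing by [ln 2] pays for the factor [ln (maxn k 2)], which is at least [ln 2]; the first phase
   needs only the constant 6. *)
exists (26 / ln 2); split=> [|n k k_gt0 le_2k]; first exact: divr_gt0.
have le_kn : (k <= n)%N by lia.
have [alg [legal correct]] := solvable_all k_gt0 le_kn.
exists alg; split=> // r ord cons.
have [le_duels win] := correct r ord cons I; split=> //.
set L := ln (maxn k 2)%:R; set l := ln 2 in ln2_gt0 *.
have le_lL : l <= L by rewrite ler_ln ?posrE ?ltr0n ?ler_nat //; lia.
have le_t : (up_log 2 k)%:R * l <= 2 * L by apply: up_log2_le_ln.
have le_t2 : (up_log 2 k <= 2 ^ (5 * k))%N.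
  have le_tk : (up_log 2 k <= k)%N by rewrite up_log_min // ltnW // ltn_expl.
  apply: leq_trans le_tk (leq_trans (ltnW (ltn_expl k (isT : 1 < 2)%N)) _).
  by rewrite leq_pexp2l //; lia.
have {}le_duels : (num_duels r alg <=
    2 * k * n * (up_log 2 k).+1 + 26 * k ^ 2 * 2 ^ (5 * k))%N.
  apply: leq_trans le_duels _; rewrite addnC leq_add2l.
  have k2_gt0 : (0 < k ^ 2)%N by rewrite expn_gt0 k_gt0.
  nia.
rewrite mulrAC ler_pdivlMr //.
move: le_duels; rewrite -(ler_nat R) natrD !natrM !natrX -natr1 => le_duels.
have kn_ge0 : 0 <= k%:R * n%:R :> R by rewrite mulr_ge0.
have k2_ge0 : 0 <= k%:R ^+ 2 * 2 ^+ (5 * k) :> R by rewrite mulr_ge0 ?exprn_ge0.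
apply: le_trans (ler_wpM2r (ltW ln2_gt0) le_duels) _.
have kn_le : k%:R * n%:R * ((up_log 2 k)%:R * l + l) <= k%:R * n%:R * (3 * L).
  by apply: ler_wpM2l => //; lra.
have k2_le := ler_wpM2l k2_ge0 le_lL.
have knL_ge0 : 0 <= k%:R * n%:R * L by rewrite mulr_ge0 // (le_trans (ltW ln2_gt0)).
by move: kn_le k2_le knL_ge0; lra.
Qed.
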